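(* Let $T>0$ and let $N$ be a Poisson random measure on $[0,T]$ with control measure $n(ds)=n(s)\,ds$. Let $g(s)$, $s\ge 0$, be a right-continuous real function satisfying $\int_0^T \min(g(s),1)\,n(ds)<\infty$, let $X_0$ be a given real random variable independent of $N$, and consider the process $$X(t)=X_0+\int_0^t g(s)\,N(ds),\qquad 0\le t\le T.$$ Let $F(x,t)=\mathrm{Prob}[X(t)\le x]$ be the cumulative distribution function of $X$ at time $t$. Then for all $(x,t)$ (with $x\in\mathbb{R}$, $0\le t<T$) such that $x-g(t)\in C(F(\cdot,t))$, $F$ satisfies the equation $$\frac{\partial}{\partial t^+}F(x,t)=-n(t)\bigl(F(x,t)-F(x-g(t),t)\bigr).$$
   Context: A Poisson random measure $N$ on $[0,T]$ (with the Borel $\sigma$-field) with control measure $n(ds)$, assumed to have a density $n(s)$, i.e. $n(ds)=n(s)\,ds$, assigns independent values to disjoint Borel sets, and $N(A)$ has a Poisson distribution with mean $\int_A n(s)\,ds$. The Poisson stochastic integral $\int_0^t g(s)\,N(ds)$ is defined as the limit in probability of the sums $\sum_i g(s_i)N([s_i,s_{i+1}))$ over partitions $0<s_1<s_2<\dots<s_m<t$ whose mesh tends to $0$. For a cumulative distribution function $G$ on $\mathbb{R}$, $C(G)$ denotes the set of points of continuity of $G$. The right time-derivative is $$\frac{\partial}{\partial t^+}F(x,t)=\lim_{h\to0^+}\frac{F(x,t+h)-F(x,t)}{h}.$$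
   Formalization: Added at the given t: (1/h)∫_t^{t+h} n(s)ds → n(t) as h→0+ (true if n is right-continuous at t). A density is fixed only a.e., and changing n at the single point t makes the equation false. *)

(* Defs.v *)
From HB Require Import structures.
From mathcomp Require Import all_boot all_order all_algebra.
From mathcomp Require Import all_classical all_reals all_analysis.
From mathcomp Require Import measurable_realfun.

Set Implicit Arguments.
Unset Strict Implicit.
Unset Printing Implicit Defensive.

Import Order.TTheory GRing.Theory Num.Theory.
Import numFieldNormedType.Exports.

Local Open Scope classical_set_scope.
Local Open Scope ring_scope.

Definition control_density (R : realType) (T : R) (n : R -> R) : Prop :=
  measurable_fun `[0, T] n /\ (forall s : R, 0 <= s <= T -> 0 <= n s).

Definition control_measure (R : realType) (n : R -> R) (A : set R) : \bar R :=
  (\int[lebesgue_measure]_(s in A) (n s)%:E)%E.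

(* A density is determined only almost everywhere; this says that n(t) is the
   value at t of the (right) density of the control measure. It holds wherever
   n is right-continuous, and at almost every t if n is locally integrable. *)
Definition right_density_at (R : realType) (n : R -> R) (t : R) : Prop :=
  ((h^-1)%:E * control_measure n `[t, (t + h)%R]%classic)%E @[h --> (0 : R)^'+]
    --> (n t)%:E.

(* The Poisson law with infinite mean is the point mass at +oo. The second
   argument of poisson_prob is a dummy; poisson_pmf is avoided because it is
   constantly 1 when the mean is 0. *)
Definition poisson_law d (U : measurableType d) (R : realType)
    (P : probability U R) (Y : U -> \bar R) (m : \bar R) : Prop :=
  if m is EFin r
  then forall k : nat,
    P (Y @^-1` [set (k%:R)%:E]) = poisson_prob r k [set k]
  else P (Y @^-1` [set +oo%E]) = 1%E.

Definition mutually_independent d (U : measurableType d) (R : realType)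
    (P : probability U R) (k : nat) (Y : 'I_k -> U -> \bar R) : Prop :=
  forall B : 'I_k -> set (\bar R), (forall i, measurable (B i)) ->
    P (\bigcap_(i in [set: 'I_k]) (Y i @^-1` B i)) =
      (\prod_(i < k) P (Y i @^-1` B i))%E.

(* The random measure is a kernel on the whole line, of which only the values
   on Borel subsets of [0, T] are used. *)
Definition poisson_random_measure d (U : measurableType d) (R : realType)
    (P : probability U R) (T : R) (n : R -> R)
    (N : R.-ker U ~> measurableTypeR R) : Prop :=
  (forall A : set (measurableTypeR R), measurable A -> A `<=` `[0, T]%classic ->
     poisson_law P (fun w => N w A) (control_measure n A)) /\
  (forall (k : nat) (A : 'I_k -> set (measurableTypeR R)),
     (forall i, measurable (A i)) -> (forall i, A i `<=` `[0, T]%classic) ->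
     trivIset setT A ->
     mutually_independent P (fun i w => N w (A i))).

Definition sigma_of_random_measure d (U : measurableType d) (R : realType)
    (T : R) (N : R.-ker U ~> measurableTypeR R) : set (set U) :=
  <<s [set E | exists (A : set (measurableTypeR R)) (B : set (\bar R)),
         [/\ measurable A, A `<=` `[0, T]%classic, measurable B
           & E = (fun w => N w A) @^-1` B] ]>>.

Definition independent_of_random_measure d (U : measurableType d)
    (R : realType) (P : probability U R) (T : R)
    (N : R.-ker U ~> measurableTypeR R) (X0 : U -> R) : Prop :=
  forall (B : set R) (E : set U),
    measurable B -> sigma_of_random_measure T N E ->
    P (X0 @^-1` B `&` E) = (P (X0 @^-1` B) * P E)%E.

(* s = [:: s_1; ...; s_m] with 0 < s_1 < ... < s_m < t; the end points are not
   listed, and for t = 0 only the empty partition remains. *)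
Definition is_partition (R : realType) (t : R) (s : seq R) : bool :=
  path <%R 0 s && all (fun u => u < t) s.

(* The gaps s_1 - 0 and t - s_m count in the mesh. *)
Definition mesh (R : realType) (t : R) (s : seq R) : R :=
  \big[Num.max/0]_(p <- zip (0 :: s) (rcons s t)) (p.2 - p.1).

(* zip drops the unmatched last point: the sum ranges over 1 <= i < m. *)
Definition riemann_sum (R : realType) (g : R -> R) (mu : set R -> \bar R)
    (s : seq R) : \bar R :=
  (\sum_(p <- zip s (behead s)) (g p.1)%:E * mu `[p.1, p.2[%classic)%E.

Definition is_poisson_integral d (U : measurableType d) (R : realType)
    (P : probability U R) (N : R.-ker U ~> measurableTypeR R)
    (g : R -> R) (t : R) (I : U -> R) : Prop :=
  forall eps eta : R, 0 < eps -> 0 < eta ->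
    exists2 delta : R, 0 < delta & forall s : seq R,
      is_partition t s -> mesh t s < delta ->
      (P [set w | (eps%:E <= `|riemann_sum g (N w) s - (I w)%:E|)%E]
         < eta%:E)%E.

Definition continuity_points (R : realType) (G : R -> R) : set R :=
  [set y | {for y, continuous G}].

Definition cdf_at d (U : measurableType d) (R : realType)
    (P : probability U R) (X : R -> {RV P >-> R}) (x t : R) : R :=
  fine (cdf (X t) x).

(* Main.v *)
(* Over a short interval [t, t + h] of control mass m the number M of points is
   0 with probability exp(-m), 1 with probability m exp(-m), and larger with
   probability O(m^2) = o(h). Comparing a fine partition of [0, t[ with an
   extension of it to [0, t + h[ shows that the increment of the integral is
   within eps M of g(t) M almost surely, where eps bounds the oscillation of g on
   ]t, t + h[. As X(t) is a limit in probability of functions of X0 and of N on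
   [0, t[, it is independent of M, so up to o(h)
     F(x, t + h) = exp(-m) F(x, t) + m exp(-m) F(x - g(t) +- eps, t),
   and m / h tends to n(t). *)
Require Import Defs.
From HB Require Import structures.
From mathcomp Require Import all_boot all_order all_algebra.
From mathcomp Require Import all_classical all_reals all_analysis.
From mathcomp Require Import measurable_realfun ring lra.
Import Order.TTheory GRing.Theory Num.Theory.
Import numFieldNormedType.Exports.
Local Open Scope classical_set_scope.
Local Open Scope ring_scope.

Set Implicit Arguments.
Unset Strict Implicit.

(** * Partitions and Riemann sums *)

(** The length [h] stays fixed while the partitions are refined: every discretisation error then has
    arbitrarily small probability, so the comparison of increments fails only on a null event and no
    rate of convergence of the Riemann sums enters the [o(h)]. The obstacle lies in the gaps. A
    Riemann sum ignores the stretches before its first and after its last point, and extending a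
    partition of [[0, t[] past [t] creates a bridging term, [g] at the last old point times the mass
    up to the first new one, which the sum for [t] does not contain. Its part before [t] has to be
    shown negligible in probability; the gaps inside [[t, t + h]] are handled by their small control
    mass. The error of the increment is proportional to the number of points, hence zero when there
    are none: [F(x, t)] enters without any shift of [x], and continuity is called for at [x - g(t)]
    alone. *)

Section partitions.
Context {R : realType}.
Implicit Types (a b c d t u v eps m : R) (r s : seq R).

(** Order and mesh bound sit in one relation, so that gluing partitions and relaxing the mesh reduce
    to [cat_path] and [sub_path]. *)
Definition step d : rel R := fun u v => (u < v) && (v < u + d).

Lemma path_step_lt d a r : path (step d) a r -> path <%R a r.
Proof. by apply: sub_path => u v /andP[]. Qed.

Lemma step_le d e u v : d <= e -> step d u v -> step e u v.
Proof. by move=> de /andP[uv vu]; rewrite /step uv; lra. Qed.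

Lemma path_step_is_partition d t s :
  path (step d) 0 (rcons s t) -> is_partition t s.
Proof.
move=> /path_step_lt pst; rewrite /is_partition.
move: (pst); rewrite rcons_path => /andP[-> _]/=.
move: pst; elim: s (0 : R) => //= y s IH a /andP[_ yst].
rewrite (IH _ yst) andbT.
by have /allP := order_path_min lt_trans yst; apply; rewrite mem_rcons mem_head.
Qed.

Lemma path_step_mesh d t s : path (step d) 0 (rcons s t) -> mesh t s < d.
Proof.
move=> pst; have d0 : 0 < d.
  by case: s pst => [|y s] /= /andP[/andP[]]; lra.
rewrite /mesh; suff main a : path (step d) a (rcons s t) ->
    \big[Num.max/0]_(p <- zip (a :: s) (rcons s t)) (p.2 - p.1) < d by exact: main.
elim: s {pst} a => [|y s IH] a /= /andP[/andP[ya yd] ps].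
  by rewrite big_cons big_nil gt_max/=; apply/andP; split => //; lra.
by rewrite big_cons gt_max IH// andbT/=; lra.
Qed.

Lemma path_step_exists d a b : 0 < d -> a <= b ->
  exists2 r, path (step d) a r & last a r = b.
Proof.
move=> d0 ab.
(* Half steps keep every gap strictly below [d]; their number drives the induction. *)
have [n bn] : exists n : nat, b - a < d / 2 * n%:R.
  exists (Num.bound ((b - a) / (d / 2))).
  rewrite mulrC -ltr_pdivrMr; last by lra.
  by apply: le_lt_trans (archi_boundP _); rewrite ?ler_norm// divr_ge0; lra.
elim: n a ab bn => [|n IH] a ab bn; first by move: bn; rewrite mulr0; lra.
have [bad|bad] := ltP b (a + d).
  move: ab; rewrite le_eqVlt => /predU1P[->|ab]; first by exists [::].
  by exists [:: b] => //=; rewrite /step ab bad.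
have [||r pr lr] := IH (a + d / 2); first by lra.
  by move: bn; rewrite -natr1; lra.
by exists (a + d / 2 :: r) => //=; rewrite pr andbT /step; lra.
Qed.

End partitions.

Section riemann_sums.
Context {R : realType} (g : R -> R).
Implicit Types (mu : set R -> \bar R) (a c eps m x : R) (r s : seq R).

(** The Riemann sum along [a :: r], with the head kept apart so that concatenation isolates the
    bridging term. *)
Fixpoint chain_sum mu a r : \bar R :=
  if r is y :: r' then ((g a)%:E * mu `[a, y[%classic + chain_sum mu y r')%E
  else 0%E.

Lemma riemann_sum_cons mu x s : riemann_sum g mu (x :: s) = chain_sum mu x s.
Proof.
rewrite /riemann_sum /=; elim: s x => [|y s IH] x /=; first by rewrite big_nil.
by rewrite big_cons IH.
Qed.

Lemma chain_sum_cat mu x s a r : chain_sum mu x (s ++ a :: r) =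
  (chain_sum mu x s + ((g (last x s))%:E * mu `[last x s, a[%classic
     + chain_sum mu a r))%E.
Proof. by elim: s x => [|y s IH] x /=; rewrite ?add0e// IH addeA. Qed.

Lemma measure_itv_split (mu : {measure set (measurableTypeR R) -> \bar R}) a b c :
  a <= b -> b <= c ->
  mu `[a, c[%classic = (mu `[a, b[%classic + mu `[b, c[%classic)%E.
Proof.
move=> ab bc; rewrite -measureU//.
- by congr (mu _); apply/seteqP; split=> z /=; rewrite !in_itv/=;
    [move=> /andP[az zc]; case: (ltP z b) => zb; [left|right]; lra|case; lra].
- by apply/seteqP; split => z //= []; rewrite !in_itv/=; lra.
Qed.

(** Finite total mass makes every piece finite, so the sum is real; an error of at most [eps] per
    unit of mass then adds up by additivity. *)
Lemma chain_sum_near (mu : {measure set (measurableTypeR R) -> \bar R})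
    a r c eps m : path <%R a r ->
  (forall y, a <= y < last a r -> `|g y - c| <= eps) ->
  mu `[a, last a r[%classic = m%:E ->
  exists2 v, chain_sum mu a r = v%:E & `|v - c * m| <= eps * m.
Proof.
elim: r a m => [|y r IH] a m /=.
  move=> _ _; rewrite set_itvco0 measure0 => -[<-].
  by exists 0; rewrite ?mulr0 ?subrr ?normr0.
move=> /andP[ay pyr] gc.
have yl : y <= last y r.
  have := order_path_min lt_trans pyr; case: (r) => // z q /allP zq.
  exact: ltW (zq (last z q) (mem_last z q)).
rewrite (@measure_itv_split _ a y (last y r)) ?(ltW ay)// => muE.
have : (0 <= mu `[a, y[%classic)%E by exact: measure_ge0.
have : (0 <= mu `[y, last y r[%classic)%E by exact: measure_ge0.
move: muE.
case Eay : (mu `[a, y[%classic) => [p| |]; case Eyl : (mu `[y, last y r[%classic) => [q| |] //=.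
move=> [<-]; rewrite !lee_fin => q0 p0.
have [|v -> vq] := IH y q pyr _ Eyl; first by move=> z /andP[yz zl]; apply: gc; lra.
exists (g a * p + v) => //.
have ga : `|g a - c| <= eps by apply: gc; lra.
have -> : g a * p + v - c * (p + q) = (g a - c) * p + (v - c * q) by ring.
rewrite mulrDr (le_trans (ler_normD _ _))// lerD// normrM (ger0_norm p0).
exact: ler_wpM2r.
Qed.

End riemann_sums.

(** * The control measure *)

Section control_measure.
Context {R : realType} {T : R} {n : R -> R}.
Hypothesis n_density : control_density T n.
Implicit Types (A B : set R) (s t h : R).

Lemma control_measure_ge0 A : A `<=` `[0, T]%classic ->
  (0 <= control_measure n A)%E.
Proof.
move=> AT; apply: integral_ge0 => x /AT; rewrite /= in_itv/= => x0T.
by rewrite lee_fin; apply: n_density.2.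
Qed.

Lemma control_measureU A B : measurable A -> measurable B ->
  A `<=` `[0, T]%classic -> B `<=` `[0, T]%classic -> [disjoint A & B] ->
  control_measure n (A `|` B) = (control_measure n A + control_measure n B)%E.
Proof.
move=> mA mB AT BT AB; rewrite /control_measure ge0_integral_setU//.
- apply/measurable_EFinP; apply: measurable_funS n_density.1 => //.
  by move=> x [/AT|/BT].
- move=> x ABx; rewrite lee_fin; apply: n_density.2.
  by case: ABx => [/AT|/BT]; rewrite /= in_itv.
Qed.

(** The set near both ends is what a Riemann sum over the interval may miss. Its mass is small by
    continuity from below: the inner intervals increase to []s, t[], which has the mass of [[s, t]]
    because points are Lebesgue null. *)
Lemma control_measure_ends s t (d e m : R) : 0 <= s -> s < t -> t <= T ->
  control_measure n `[s, t]%classic = m%:E -> 0 < d -> 0 < e ->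
  exists a b z, [/\ s < a < s + d, t - d < b < t, a <= b,
    control_measure n (`[s, a[%classic `|` `[b, t]%classic) = z%:E & 0 <= z < e].
Proof.
move=> s0 st tT muE d0 e0.
(* The offset 3 gives [c k * 2 < t - s], so the inner interval is never empty. *)
pose c k : R := (t - s) / k.+3%:R.
have c0 k : 0 < c k by rewrite divr_gt0// subr_gt0.
have c2 k : c k * 2 < t - s.
  by rewrite /c mulrAC ltr_pdivrMr// ltr_pM2l ?subr_gt0// ltr_nat.
pose F k := `[s + c k, t - c k[%classic.
have FT k : F k `<=` `[0, T]%classic.
  by move=> x; rewrite /F/= !in_itv/=; have := c0 k; lra.
have nbc (e' : R) : 0 < e' -> \forall k \near \oo, c k < e'.
  move=> e'0; near=> j.
  rewrite ltr_pdivrMr// mulrC -ltr_pdivrMr// (@lt_trans _ _ j%:R)//; last first.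
    by rewrite ltr_nat -addn3 -addn1 leq_add2l.
  by near: j; exact: nbhs_infty_gtr.
have UF : \bigcup_k F k = `]s, t[%classic.
  apply/seteqP; split=> x.
    by move=> [k _]; rewrite /F/= !in_itv/=; have := c0 k; lra.
  rewrite /= in_itv/= => /andP[sx xt].
  have xs0 : 0 < x - s by lra.
  have tx0 : 0 < t - x by lra.
  have [k [k1 k2]] := filter_ex (filterI (nbc _ xs0) (nbc _ tx0)).
  by exists k => //; rewrite /F/= in_itv/=; lra.
have cvgF : control_measure n (F k) @[k --> \oo] --> m%:E.
  have itvE : control_measure n `]s, t[%classic = m%:E.
    have mn (i : interval R) : [set` i] `<=` `[s, t]%classic ->
        measurable_fun [set` i] (EFin \o n).
      move=> ist; apply/measurable_EFinP; apply: measurable_funS n_density.1 => //.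
      by move=> x /ist; rewrite /= !in_itv/=; lra.
    rewrite -muE /control_measure integral_itv_bndo_bndc ?integral_itv_obnd_cbnd//.
      by apply: mn => x /=; rewrite !in_itv/=; lra.
    by apply: mn => x /=; rewrite !in_itv/=; lra.
  rewrite -itvE -UF; apply: ge0_nondecreasing_set_cvg_integral.
  - apply/nondecreasing_seqP => k; apply/subsetPset => x.
    rewrite /F/= !in_itv/=.
    have : c k.+1 <= c k.
      by rewrite /c ler_pM2l ?subr_gt0// lef_pV2 ?posrE// ler_nat.
    lra.
  - by move=> k; exact: measurable_itv.
  - move=> k; apply/measurable_EFinP.
    by apply: measurable_funS n_density.1.
  - move=> k x /FT; rewrite /= in_itv/= lee_fin; exact: n_density.2.
have nbF : \forall k \near \oo, ((m - e)%:E < control_measure n (F k))%E.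
  apply: (cvgF [set y | ((m - e)%:E < y)%E]); apply: open_nbhs_nbhs.
  split; first exact: open_ereal_gt_ereal.
  by rewrite /= lte_fin; lra.
have [k [kd Fe]] := filter_ex (filterI (nbc _ d0) nbF).
have ckpos := c0 k; have ck2 := c2 k.
pose Z := `[s, s + c k[%classic `|` `[t - c k, t]%classic.
have ZT : Z `<=` `[0, T]%classic.
  by move=> x []; rewrite /= !in_itv/=; lra.
have mZ : measurable Z by exact: measurableU.
have stE : `[s, t]%classic = Z `|` F k.
  apply/seteqP; split=> x; rewrite /Z /F/= !in_itv/=; last lra.
  move=> sxt; case: (ltP x (s + c k)) => ?; first by left; left; lra.
  by case: (ltP x (t - c k)) => ?; [right|left; right]; lra.
have ZF : [disjoint Z & F k].
  apply/disj_setPS => x []; rewrite /Z /F/= !in_itv/=; lra.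
have := muE; rewrite stE (control_measureU mZ (measurable_itv _) ZT (FT k) ZF).
have := control_measure_ge0 ZT; have := control_measure_ge0 (FT k).
move: Fe; case EF : (control_measure n (F k)) => [p| |]//;
  case EZ : (control_measure n Z) => [z| |]//.
rewrite lte_fin !lee_fin => mp p0 z0 [zp].
by exists (s + c k), (t - c k), z; split => //; lra.
Unshelve. all: by end_near.
Qed.

End control_measure.

(** * Riemann sums against the random measure *)

Section real_probability.
Context d {U : measurableType d} {R : realType} (P : probability U R).
Implicit Types A B C : set U.

Local Notation pr E := (fine (P E)).

Lemma pr_ge0 A : 0 <= pr A. Proof. exact/fine_ge0. Qed.

Lemma pr_le A B : measurable A -> measurable B -> A `<=` B -> pr A <= pr B.
Proof.
by move=> mA mB AB; rewrite fine_le ?fin_num_measure// le_measure ?inE.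
Qed.

Lemma pr_le1 A : measurable A -> pr A <= 1.
Proof. by move=> mA; rewrite -lee_fin fineK ?fin_num_measure// probability_le1. Qed.

Lemma pr_le_setU A B C : measurable A -> measurable B -> measurable C ->
  A `<=` B `|` C -> pr A <= pr B + pr C.
Proof.
move=> mA mB mC ABC; rewrite -lee_fin EFinD !fineK ?fin_num_measure//.
rewrite (@le_trans _ _ (P (B `|` C)))//.
  by rewrite le_measure ?inE//; exact: measurableU.
exact: measureU2.
Qed.

Lemma pr_setIC A B : measurable A -> measurable B ->
  pr A = pr (A `&` B) + pr (A `&` ~` B).
Proof.
move=> mA mB; rewrite -fineD ?fin_num_measure//; last 2 first.
- exact: measurableI.
- by apply: measurableI => //; exact: measurableC.
rewrite -measureU//.
- by rewrite -setIUr setUCr setIT.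
- exact: measurableI.
- by apply: measurableI => //; exact: measurableC.
- by rewrite setIACA setICr setI0.
Qed.

End real_probability.

Lemma abse_sub_lt_fin {R : realType} (x : \bar R) (y e : R) :
  (`|x - y%:E| < e%:E)%E -> exists2 r, x = r%:E & `|r - y| < e.
Proof. by case: x => [r| |]//=; rewrite lte_fin; exists r. Qed.

Section random_riemann_sums.
Context d {U : measurableType d} {R : realType} (P : probability U R).
Context (N : R.-ker U ~> measurableTypeR R) (g : R -> R).
Implicit Types (A : set (measurableTypeR R)) (s : seq R) (e t u : R).

Local Notation pr E := (fine (P E)).

Definition riemann_error s e (I : U -> R) : set U :=
  [set w | (e%:E <= `|riemann_sum g (N w) s - (I w)%:E|)%E].

Lemma measurable_riemann_sum s :
  measurable_fun setT (fun w => riemann_sum g (N w) s).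
Proof.
apply: (@emeasurable_sum _ _ _ _ _ _ (fun p w => ((g p.1)%:E * N w `[p.1, p.2[%classic)%E)).
by move=> p; apply: measurable_funeM; exact: measurable_kernel.
Qed.

Lemma measurable_riemann_error s e (I : {RV P >-> R}) :
  measurable (riemann_error s e I).
Proof.
rewrite /riemann_error -[X in measurable X]setTI.
apply: emeasurable_fun_c_infty => //.
apply: measurableT_comp => //; apply: emeasurable_funB => //.
  exact: measurable_riemann_sum.
exact/measurable_EFinP.
Qed.

(* When the control measure is infinite on every left neighbourhood of [t],
   [N [u, t[] itself does not tend to [0]; only its product with [g u] does,
   because two fine partitions ending at [u] and at [v > u] have close sums. *)
Lemma last_gap_negligible t (I : {RV P >-> R}) (e h : R) : 0 < t ->
  is_poisson_integral P N g t I -> 0 < e -> 0 < h ->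
  exists2 dlt, 0 < dlt & forall u, 0 < u < t -> t - dlt < u ->
    pr [set w | (e%:E < `|g u|%:E * N w `[u, t[%classic)%E] <= h.
Proof.
move=> t0 It e0 h0.
have [||dlt dlt0 Hd] := It (e / 2) (h / 2); [by lra|by lra|].
exists dlt => // u /andP[u0 ut] tu.
have [|[|x s0] ps lu] := path_step_exists dlt0 (b := u) (a := 0); first exact: ltW.
  by move: lu => /= lu; move: u0; rewrite lu ltxx.
rewrite /= in lu.
have ut_step : step dlt u t by rewrite /step; lra.
pose E v := [set w | (e%:E < `|g u|%:E * N w `[u, v[%classic)%E].
have mE v : measurable (E v).
  rewrite /E -[X in measurable X]setTI.
  apply: emeasurable_fun_o_infty => //.
  by apply: measurable_funeM; exact: measurable_kernel.
have PEv v : u < v < t -> pr (E v) <= h.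
  move=> /andP[uv vt].
  have small s : path (step dlt) 0 (rcons s t) ->
      pr (riemann_error s (e / 2) I) <= h / 2.
    move=> pst; rewrite -lee_fin fineK ?fin_num_measure//.
      by apply/ltW/Hd; [exact: path_step_is_partition pst|exact: path_step_mesh].
    exact: measurable_riemann_error.
  apply: (@le_trans _ _ (pr (riemann_error (x :: s0) (e / 2) I) +
    pr (riemann_error (rcons (x :: s0) v) (e / 2) I))); last first.
    rewrite (splitr h); apply: lerD; apply: small.
      by rewrite rcons_path ps /= lu.
    by rewrite !rcons_path ps last_rcons /= lu /step; lra.
  apply: pr_le_setU; [exact: mE|exact: measurable_riemann_error..|].
  move=> w; rewrite /E/riemann_error /= => ew.
  apply: contrapT => /not_orP[/negP + /negP]; rewrite -!ltNge.
  move=> /abse_sub_lt_fin[r rE ri] /abse_sub_lt_fin[q].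
  move: rE; rewrite -cats1 /= !riemann_sum_cons chain_sum_cat lu /= adde0 => ->.
  have : (0 <= N w `[u, v[%classic)%E by [].
  move: ew; case: (N w `[u, v[%classic) => [y| |]//.
    rewrite -!EFinM -EFinD lte_fin lee_fin => ew y0 [qE] qi.
    have : `|q - I w - (r - I w)| < e.
      by rewrite (le_lt_trans (ler_normB _ _))//; lra.
    have -> : q - I w - (r - I w) = g u * y by rewrite -qE; ring.
    by rewrite normrM (ger0_norm y0) => /(lt_trans ew); rewrite ltxx.
  (* An infinite mass makes the longer sum infinite, against its closeness to [I w], unless
     [g u = 0]; then the product is 0 and cannot exceed [e]. *)
  have [->|gu _ _] := eqVneq (g u) 0; first by rewrite normr0 mul0e lte_fin; lra.
  by rewrite mulr_infty; case: (sgrP (g u)) gu => //=; rewrite ?mul1e ?mulN1e.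
(* Partition points lie strictly below [t], so the bound is reached along [v k] increasing to [t],
   by continuity from below of [N w] and then of [P]. The offset 2 keeps [v k] above [u]. *)
pose v k : R := t - (t - u) / k.+2%:R.
have uv k : u < v k < t.
  rewrite /v; have : 0 < (t - u) / k.+2%:R by rewrite divr_gt0//; lra.
  have : (t - u) / k.+2%:R < t - u.
    by rewrite ltr_pdivrMr// ltr_pMr ?ltr1n//; lra.
  by move: (_ / _) => c; lra.
have vS k : v k <= v k.+1.
  by rewrite /v lerD2l lerN2 ler_pM2l ?subr_gt0// lef_pV2 ?posrE// ler_nat.
have Uv : \bigcup_k `[u, v k[%classic = `[u, t[%classic.
  apply/seteqP; split => z; first by move=> [k _]; rewrite /= !in_itv/=; have := uv k; lra.
  rewrite /= in_itv/= => /andP[uz zt].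
  have tz : 0 < t - z by lra.
  exists (Num.bound ((t - u) / (t - z))) => //=; rewrite in_itv/= uz/= /v.
  set k := Num.bound _; suff : (t - u) / k.+2%:R < t - z by move: (_ / _) => c; lra.
  rewrite ltr_pdivrMr// mulrC -ltr_pdivrMr//.
  apply: (@lt_trans _ _ k%:R); last by rewrite ltr_nat.
  by apply: archi_boundP; rewrite divr_ge0//; lra.
have cvgN w : N w `[u, v k[%classic @[k --> \oo] --> N w `[u, t[%classic.
  rewrite -Uv; apply: nondecreasing_cvg_mu.
  - by move=> k; exact: measurable_itv.
  - by apply: bigcupT_measurable => k; exact: measurable_itv.
  - apply/nondecreasing_seqP => k; apply/subsetPset => z /=.
    by rewrite !in_itv/=; have := vS k; lra.
have EU : E t `<=` \bigcup_k E (v k).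
  move=> w; rewrite /E/= => ew.
  have cvgM : (`|g u|%:E * N w `[u, v k[%classic)%E @[k --> \oo] -->
      (`|g u|%:E * N w `[u, t[%classic)%E.
    by apply: cvgeZl => //; exact: cvgN.
  have nE : \forall k \near \oo, (e%:E < `|g u|%:E * N w `[u, v k[%classic)%E.
    apply: (cvgM [set y | (e%:E < y)%E]); apply: open_nbhs_nbhs.
    by split; first exact: open_ereal_gt_ereal.
  by have [k ke] := filter_ex nE; exists k.
have mUE : measurable (\bigcup_k E (v k)) by apply: bigcupT_measurable.
apply: (le_trans (pr_le P (mE t) mUE EU)).
rewrite -lee_fin fineK ?fin_num_measure//.
have cvgP : P (E (v k)) @[k --> \oo] --> P (\bigcup_k E (v k)).
  apply: nondecreasing_cvg_mu => //.
  apply/nondecreasing_seqP => k; apply/subsetPset => w; rewrite /E/= => /lt_le_trans; apply.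
  apply: lee_wpmul2l => //; apply: le_measure; rewrite ?inE; [exact: measurable_itv..|].
  by move=> z; rewrite /= !in_itv/=; have := vS k; lra.
rewrite -(cvg_lim _ cvgP)//; apply: lime_le; first by apply/cvg_ex; eexists; exact: cvgP.
by apply: nearW => k; rewrite -(fineK (fin_num_measure P _ (mE (v k)))) lee_fin PEv.
Qed.

End random_riemann_sums.

(** * Increments of the Poisson integral *)

(** For [y = +oo] the bound forces [c = 0], and the product is then 0 by convention. *)
Lemma normr_mule_le_fin {R : realType} (c e : R) (y : \bar R) : (0 <= y)%E ->
  (`|c|%:E * y <= e%:E)%E -> exists2 q, (c%:E * y = q%:E)%E & `|q| <= e.
Proof.
case: y => [y| |]//.
  rewrite !lee_fin => y0 cy; exists (c * y); rewrite ?EFinM//.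
  by rewrite normrM (ger0_norm y0).
move=> _; have [->|c0] := eqVneq c 0.
  by rewrite normr0 !mul0e lee_fin => e0; exists 0; rewrite ?normr0.
by rewrite mulry gtr0_sg ?normr_gt0// mul1e leye_eq.
Qed.

Section poisson_increments.
Context d {U : measurableType d} {R : realType} (P : probability U R).
Context (T : R) (n : R -> R) (N : R.-ker U ~> measurableTypeR R) (g : R -> R).
Hypothesis n_density : control_density T n.
Hypothesis N_poisson : poisson_random_measure P T n N.
Implicit Types (A : set (measurableTypeR R)) (s : seq R) (e t u : R).

Local Notation pr E := (fine (P E)).

Definition count_event A (k : nat) : set U :=
  (fun w => N w A) @^-1` [set (k%:R)%:E].

Lemma measurable_count_event A k : measurable A -> measurable (count_event A k).
Proof.
move=> mA; rewrite /count_event -[X in measurable X]setTI.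
by apply: measurable_kernel => //; exact: emeasurable_set1.
Qed.

Lemma pr_count_event A m : measurable A -> A `<=` `[0, T]%classic ->
  control_measure n A = m%:E ->
  pr (count_event A 0) = expR (- m) /\ pr (count_event A 1) = m * expR (- m).
Proof.
move=> mA AT mE; have := N_poisson.1 A mA AT; rewrite /poisson_law mE => NA.
have m0 : 0 <= m by rewrite -lee_fin -mE; exact: control_measure_ge0 n_density _ AT.
(* For mean 0, [poisson_prob] is the Dirac mass at 0 and not given by [poisson_pmf]. *)
rewrite !NA /poisson_prob; move: m0; rewrite le_eqVlt => /predU1P[<-|m0].
  rewrite ltxx !diracE oppr0 expR0 mul0r mem_set//= memNset//.
rewrite m0 !esum_set1 ?lee_fin ?poisson_pmf_ge0//= /poisson_pmf m0.
by rewrite expr0 expr1 fact0 factS fact0 invr1 !mul1r mulr1.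
Qed.

Lemma riemann_approximation t (I : {RV P >-> R}) e h dlt : 0 <= t ->
  is_poisson_integral P N g t I -> 0 < e -> 0 < h -> 0 < dlt ->
  exists s B, [/\ measurable B, pr B <= h, pr (riemann_error N g s e I) <= h
    & if s is x :: s0 then
        path (step dlt) 0 (rcons s t) /\
        forall w, (~` B) w -> (`|g (last x s0)|%:E * N w `[last x s0, t[%classic <= e%:E)%E
      else t = 0].
Proof.
move=> t0 It e0 h0 dlt0.
have [d1 d10 H1] := It e h e0 h0.
have PE s : is_partition t s -> mesh t s < d1 -> pr (riemann_error N g s e I) <= h.
  move=> ps ms; rewrite -lee_fin fineK ?fin_num_measure//; first by exact/ltW/H1.
  exact: measurable_riemann_error.
move: t0; rewrite le_eqVlt => /predU1P[t0|t0].
  exists [::], set0; split => //; first by rewrite measure0 ltW.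
  by apply: PE; rewrite -t0// /mesh/= big_cons big_nil gt_max/=; lra.
have [d2 d20 H2] := last_gap_negligible t0 It e0 h0.
(* The four bounds serve the requested mesh, the approximation of [I], the negligible last gap, and
   [0 < u]. *)
pose dl := Num.min (Num.min dlt d1) (Num.min d2 t).
have dl0 : 0 < dl by rewrite !lt_min dlt0 d10 d20.
have [dl1 dl2 dl3 dl4] : [/\ dl <= dlt, dl <= d1, dl <= d2 & dl <= t].
  by rewrite /dl; split; rewrite !ge_min lexx ?orbT.
pose u := t - dl / 2.
have [|[|x s0] ps lu] := path_step_exists dl0 (b := u) (a := 0).
- by rewrite /u; lra.
- by move: lu; rewrite /u/=; lra.
rewrite /= in lu.
have pst : path (step dl) 0 (rcons (x :: s0) t).
  by rewrite rcons_path ps/= lu /step /u; lra.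
exists (x :: s0), [set w | (e%:E < `|g u|%:E * N w `[u, t[%classic)%E]; split.
- rewrite -[X in measurable X]setTI; apply: emeasurable_fun_o_infty => //.
  by apply: measurable_funeM; exact: measurable_kernel.
- by apply: H2; rewrite /u; lra.
- apply: PE; first exact: path_step_is_partition pst.
  exact: lt_le_trans (path_step_mesh pst) dl2.
- split; first by apply: sub_path pst => y z; exact: step_le.
  by rewrite lu => w /= /negP; rewrite -leNgt.
Qed.

Lemma measurable_near_event A (I I' : {RV P >-> R}) (c e : R) (j : nat) :
  measurable A ->
  measurable (count_event A j `&` [set w | e <= `|I' w - I w - c|]).
Proof.
move=> mA; apply: measurableI; first exact: measurable_count_event.
pose f w := `|I' w - I w - c|.
have mf : measurable_fun setT f.
  apply: measurableT_comp => //; apply: measurable_funB => //.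
  exact: measurable_funB.
rewrite (_ : [set w | _] = setT `&` f @^-1` `[e, +oo[%classic).
  by apply: mf => //; exact: measurable_itv.
by rewrite setTI; apply/seteqP; split=> w /=; rewrite in_itv/= andbT.
Qed.

Lemma increment_near_except t t' (I I' : {RV P >-> R}) (eps m e : R) (j : nat) :
  0 <= t -> t < t' -> t' <= T ->
  control_measure n `[t, t']%classic = m%:E ->
  is_poisson_integral P N g t I -> is_poisson_integral P N g t' I' ->
  (forall r, t < r < t' -> `|g r - g t| <= eps) -> 0 < e ->
  pr (count_event `[t, t']%classic j `&`
      [set w | eps * j%:R + e <= `|I' w - I w - g t * j%:R|]) = 0.
Proof.
move=> t0 tt' t'T mE It It' geps e0.
set E := _ `&` _.
have mJ : measurable (count_event `[t, t']%classic j).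
  exact: measurable_count_event.
have mE' : measurable E by exact: measurable_near_event.
(* Four exceptional events of probability at most [h] each: a large term over the last gap before
   [t], a bad sum for [I], a bad sum for [I'], and points in the end gaps of [[t, t']]. *)
suff PE h : 0 < h -> pr E <= h * 4.
  apply/eqP; rewrite eq_le pr_ge0 andbT; apply/ler_addgt0Pl => h h0.
  by rewrite addr0; have := PE (h / 4); rewrite divfK//; apply; lra.
move=> h0.
(* The three thirds are for the two Riemann sums and the bridging term. *)
pose e3 := e / 3.
have e30 : 0 < e3 by rewrite /e3; lra.
have [d' d'0 H'] := It' e3 h e30 h0.
(* The gap joining the two partitions contains [t]; each side of [t] gets half of the mesh [d']. *)
have d'20 : 0 < d' / 2 by lra.
have [s [B [mB PB Ps sP]]] := riemann_approximation t0 It e30 h0 d'20.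
have [a [b [z [tat bt' ab zE zh]]]] :=
  control_measure_ends n_density t0 tt' t'T mE d'20 h0.
have [r pathr lr] := path_step_exists d'0 ab.
set Z := _ `|` _ in zE.
have ZT : Z `<=` `[0, T]%classic by move=> y [] ; rewrite /= !in_itv/=; lra.
have mZ : measurable (Z : set (measurableTypeR R)).
  by apply: measurableU; exact: measurable_itv.
have [PZ _] := pr_count_event mZ ZT zE.
pose s' := s ++ a :: r.
have ps' : path (step d') 0 (rcons s' t').
  rewrite /s' rcons_cat rcons_cons cat_path /= rcons_path pathr lr /=.
  have bt : step d' b t' by rewrite /step; lra.
  rewrite bt andbT; case: s sP {Ps s'} => [t00|x s0 []]; first by rewrite /= /step; lra.
  rewrite rcons_path => /andP[ps ls] _; rewrite andbC /=; apply/andP; split.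
    by move: ls; rewrite /step/=; lra.
  by apply: sub_path ps => y z' /step_le; apply; lra.
have Ps' : pr (riemann_error N g s' e3 I') <= h.
  rewrite -lee_fin fineK ?fin_num_measure//; last exact: measurable_riemann_error.
  by apply/ltW/H'; [exact: path_step_is_partition ps'|exact: path_step_mesh].
have mZ0 := measurable_count_event 0 mZ.
have mZ0' := measurableC mZ0.
have PZh : fine (P (~` count_event Z 0)) <= h.
  rewrite probability_setC// -(fineK (fin_num_measure P _ mZ0)) PZ -EFinB/=.
  by have := expR_ge1Dx (- z); lra.
pose E1 := B `|` riemann_error N g s e3 I.
pose E2 := riemann_error N g s' e3 I' `|` ~` count_event Z 0.
have me := @measurable_riemann_error _ _ _ P N g.
have mE1 : measurable E1 by apply: measurableU => //; exact: me.
have mE2 : measurable E2 by apply: measurableU => //; exact: me.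
have P1 : fine (P E1) <= h + h.
  by apply: le_trans (lerD PB Ps); apply: pr_le_setU => //; exact: me.
have P2 : fine (P E2) <= h + h.
  by apply: le_trans (lerD Ps' PZh); apply: pr_le_setU => //; exact: me.
suff EE : E `<=` E1 `|` E2.
  by have := pr_le_setU P mE' mE1 mE2 EE; lra.
move=> w [/= Nj bad]; apply: contrapT.
move=> /not_orP[/not_orP[nB /negP ns] /not_orP[/negP ns' /contrapT nZ]].
move: ns ns'; rewrite -!ltNge => /abse_sub_lt_fin[r0 r0E r0I] /abse_sub_lt_fin[q qE qI].
(* No point falls in [Z], so all [j] points of [[t, t']] lie in [[a, b[], where the new partition
   sees them. *)
have sub0 A : measurable A -> A `<=` Z -> N w A = 0%E.
  move=> mA AZ; apply/eqP; rewrite eq_le measure_ge0 andbT -[leRHS]nZ.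
  by apply: le_measure; rewrite ?inE.
have Nta : N w `[t, a[%classic = 0%E.
  by apply: sub0; [exact: measurable_itv|move=> y; left].
have Nbt : N w `[b, t']%classic = 0%E.
  by apply: sub0; [exact: measurable_itv|move=> y; right].
have Nab : N w `[a, b[%classic = (j%:R)%:E.
  rewrite -Nj (_ : `[t, t']%classic = Z `|` `[a, b[%classic); last first.
    apply/seteqP; split=> y; rewrite /Z /= !in_itv/=; last lra.
    move=> tyt; case: (ltP y a) => ?; first by left; left; lra.
    by case: (ltP y b) => ?; [right|left; right]; lra.
  rewrite measureU//; last first.
    by apply/seteqP; split=> y //; rewrite /Z /= !in_itv/=; lra.
  by rewrite [X in (X + _)%E]nZ add0e.
rewrite -lr in Nab.
have [|y yt|v vE vb] := chain_sum_near (g := g) (c := g t) (eps := eps) _ _ Nab.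
- exact: path_step_lt pathr.
- by apply: geps; move: yt; rewrite lr; lra.
(* [p] is the bridging term; it is 0 when [t = 0], as the old partition is then empty. *)
suff [p qp pe] : exists2 p, q = r0 + (p + v) & `|p| <= e3.
  have : `|I' w - I w - g t * j%:R| <= `|q - I' w| + `|r0 - I w| + `|p| + `|v - g t * j%:R|.
    have -> : I' w - I w - g t * j%:R =
       - (q - I' w) + (r0 - I w) + p + (v - g t * j%:R) by rewrite qp; ring.
    apply: le_trans (ler_normD _ _) _; rewrite lerD2r.
    apply: le_trans (ler_normD _ _) _; rewrite lerD2r.
    by apply: le_trans (ler_normD _ _) _; rewrite normrN.
  by move: bad r0I qI pe; rewrite /e3; lra.
case: s sP @s' r0E qE {ps' Ps Ps' E1 E2 mE1 mE2 P1 P2} => [_|x s0 [pst Bs]] s'.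
  rewrite /riemann_sum big_nil /s' cat0s -/(riemann_sum g (N w) (a :: r)).
  rewrite riemann_sum_cons vE => -[<-] [<-].
  by exists 0; rewrite ?add0r// normr0 ltW.
rewrite /s' cat_cons !riemann_sum_cons chain_sum_cat vE => -> .
have lt' : last x s0 < t.
  by move: pst; rewrite rcons_path => /andP[_ /andP[]].
rewrite (@measure_itv_split _ (N w) (last x s0) t a) ?ltW//; last by lra.
rewrite Nta adde0.
have [p -> pe] := normr_mule_le_fin (measure_ge0 _ _) (Bs w nB).
by rewrite -!EFinD => -[<-]; exists p.
Qed.

Lemma increment_near t t' (I I' : {RV P >-> R}) (eps m : R) (j : nat) :
  0 <= t -> t < t' -> t' <= T ->
  control_measure n `[t, t']%classic = m%:E ->
  is_poisson_integral P N g t I -> is_poisson_integral P N g t' I' ->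
  (forall r, t < r < t' -> `|g r - g t| <= eps) ->
  P.-negligible (count_event `[t, t']%classic j `&`
      [set w | eps * j%:R < `|I' w - I w - g t * j%:R|]).
Proof.
move=> t0 tt' t'T mE It It' geps.
pose E k := count_event `[t, t']%classic j `&`
  [set w | eps * j%:R + k.+1%:R^-1 <= `|I' w - I w - g t * j%:R|].
apply: (@negligibleS _ _ _ _ (\bigcup_k E k)).
  move=> w [Nj /= bad].
  set x := `|_| in bad.
  have x0 : 0 < x - eps * j%:R by lra.
  exists (Num.bound (x - eps * j%:R)^-1) => //; split => //=; rewrite -/x.
  rewrite -lerBrDl invf_ple ?posrE//; apply: (@le_trans _ _ (Num.bound (x - eps * j%:R)^-1)%:R).
    by rewrite ltW// archi_boundP// invr_ge0 ltW.
  by rewrite ler_nat.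
apply: negligible_bigcup => k.
have mE' : measurable (E k).
  by apply: measurable_near_event; exact: measurable_itv.
exists (E k); split => //; apply/eqP; rewrite -fine_eq0 ?fin_num_measure//.
by rewrite (increment_near_except j t0 tt' t'T mE It It' geps).
Qed.

End poisson_increments.

(** * Independence of the past *)

(* The term of the last index vanishes: [nth] defaults to [0] past the end, so
   its interval [[s_m, 0[] is empty. *)
Lemma riemann_sum_nth {R : realType} (g : R -> R)
    (mu : {measure set (measurableTypeR R) -> \bar R}) (s : seq R) :
  all (fun x => 0 <= x) s -> riemann_sum g mu s =
    (\sum_(i < size s) (g (nth 0%R s i))%:E * mu `[nth 0%R s i, nth 0%R s i.+1[%classic)%E.
Proof.
case: s => [|x s]; first by rewrite /riemann_sum big_nil big_ord0.
rewrite riemann_sum_cons; elim: s x => [|y s IH] x /=.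
  rewrite andbT big_ord_recl big_ord0/= => x0.
  by rewrite set_itv_ge ?measure0 ?mule0 ?adde0// bnd_simp -leNgt.
by move=> /andP[_ ys]; rewrite big_ord_recl /= (IH y ys).
Qed.

(** Of the later interval only the left end matters, so the default value of [nth] at the last index
    does no harm. *)
Lemma trivIset_sorted_itv {R : realType} (s : seq R) : sorted <=%R s ->
  trivIset setT (fun i : 'I_(size s) => `[nth 0 s i, nth 0 s i.+1[%classic) .
Proof.
move=> ss; suff main (i j : 'I_(size s)) : (i < j)%N ->
    `[nth 0 s i, nth 0 s i.+1[%classic `&` `[nth 0 s j, nth 0 s j.+1[%classic = set0.
  apply/trivIsetP => i j _ _; rewrite neq_lt => /orP[|] ij; first exact: main.
  by rewrite setIC; exact: main.
move=> ij; have := sorted_leq_nth le_trans lexx 0 ss i.+1 j.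
rewrite !inE (leq_ltn_trans ij)// ltn_ord => /(_ isT isT ij) le_ij.
by rewrite -subset0 => z /=; rewrite !in_itv/=; lra.
Qed.

(** Both sides are finite measures in [E] that agree on a pi-system. *)
Lemma independent_g_sigma_algebra d {U : measurableType d} {R : realType}
    (P : probability U R) (G : set (set U)) (C : set U) :
  setI_closed G -> G setT -> G `<=` measurable -> measurable C ->
  (forall E, G E -> P (E `&` C) = (P E * P C)%E) ->
  forall E, <<s G >> E -> P (E `&` C) = (P E * P C)%E.
Proof.
move=> GI GT Gm mC GC E GE.
have c0 : 0 <= fine (P C) by exact/fine_ge0.
pose m2 := mscale (NngNum c0) P.
have m2E A : measurable A -> m2 A = (P A * P C)%E.
  by move=> mA; rewrite /m2 /mscale/= fineK ?fin_num_measure// muleC.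
have mGE : measurable E.
  by have := GE; apply: smallest_sub => //; exact: sigma_algebra_measurable.
rewrite -m2E//.
apply: (@g_sigma_algebra_measure_unique _ _ _ G Gm (fun=> setT) _ _ (mrestr P mC)) => //.
- by rewrite bigcup_const.
- by move=> A GA; rewrite [RHS]m2E; [exact: GC|exact: Gm].
- by move=> _; rewrite (@le_lt_trans _ _ 1%E) ?ltry// probability_le1//; exact: measurableI.
Qed.

Section independence.
Context d {U : measurableType d} {R : realType} (P : probability U R).
Context (T : R) (n : R -> R) (N : R.-ker U ~> measurableTypeR R) (g : R -> R).
Hypothesis N_poisson : poisson_random_measure P T n N.
Context (X0 : {RV P >-> R}).
Hypothesis X0_indep : independent_of_random_measure P T N X0.

Lemma sigma_of_random_measure_eval (A : set (measurableTypeR R)) (B : set (\bar R)) :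
  measurable A -> A `<=` `[0, T]%classic -> measurable B ->
  sigma_of_random_measure T N ((fun w => N w A) @^-1` B).
Proof.
move=> mA AT mB; rewrite /sigma_of_random_measure.
by apply: sub_gen_smallest; exists A, B.
Qed.

Lemma sigma_of_random_measureI (E F : set U) : sigma_of_random_measure T N E ->
  sigma_of_random_measure T N F -> sigma_of_random_measure T N (E `&` F).
Proof. exact: (@measurableI _ (g_sigma_algebraType _)). Qed.

Lemma sigma_of_random_measure_bigcap k (E : 'I_k -> set U) :
  (forall i, sigma_of_random_measure T N (E i)) ->
  sigma_of_random_measure T N (\bigcap_(i in [set: 'I_k]) E i).
Proof.
move=> mE; apply: (@fin_bigcap_measurable _ (g_sigma_algebraType _)) => // i _.
exact: mE.
Qed.

(** A pi-system generating the sigma-algebra of [X0] and the masses [N (A i)] jointly; its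
    rectangular form fits both independence hypotheses. *)
Definition cylinder k (A : 'I_k -> set (measurableTypeR R)) : set (set U) :=
  [set E | exists (B0 : set R) (B : 'I_k -> set (\bar R)),
     [/\ measurable B0, forall i, measurable (B i) &
       E = X0 @^-1` B0 `&` \bigcap_(i in setT) (fun w => N w (A i)) @^-1` B i] ].

Lemma cylinder_setI k (A : 'I_k -> set (measurableTypeR R)) :
  setI_closed (cylinder A).
Proof.
move=> _ _ [B0 [B [mB0 mB ->]]] [C0 [C [mC0 mC ->]]].
exists (B0 `&` C0), (fun i => B i `&` C i); split.
- exact: measurableI.
- by move=> i; exact: measurableI.
- by rewrite setIACA -preimage_setI -bigcapI.
Qed.

Lemma cylinder_setT k (A : 'I_k -> set (measurableTypeR R)) :
  cylinder A setT.
Proof.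
exists setT, (fun=> setT); split => //.
by rewrite preimage_setT setTI; apply/esym; rewrite -subTset => w _ i.
Qed.

Lemma cylinder_measurable k (A : 'I_k -> set (measurableTypeR R)) :
  (forall i, measurable (A i)) -> cylinder A `<=` measurable.
Proof.
move=> mA _ [B0 [B [mB0 mB ->]]]; apply: measurableI.
  by rewrite -[X in measurable X]setTI; exact: measurable_funP.
apply: fin_bigcap_measurable => // i _; rewrite -[X in measurable X]setTI.
by apply: measurable_kernel.
Qed.

Lemma cylinder_independent k (A : 'I_k -> set (measurableTypeR R))
    (J : set (measurableTypeR R)) (C : set (\bar R)) :
  (forall i, measurable (A i)) -> (forall i, A i `<=` `[0, T]%classic) ->
  trivIset setT A -> measurable J -> J `<=` `[0, T]%classic ->
  (forall i, A i `&` J = set0) -> measurable C ->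
  forall E, cylinder A E ->
    P (E `&` (fun w => N w J) @^-1` C) = (P E * P ((fun w => N w J) @^-1` C))%E.
Proof.
move=> mA AT tA mJ JT AJ mC _ [B0 [B [mB0 mB ->]]].
(* [J] joins the family as index 0, so that independence of disjoint sets applies to all of them at
   once. *)
pose A' (i : 'I_k.+1) := oapp A J (unlift ord0 i).
pose B' D (i : 'I_k.+1) := oapp B D (unlift ord0 i).
have mA' i : measurable (A' i) by rewrite /A'; case: unliftP => [j|] _ /=.
have mB' D : measurable D -> forall i, measurable (B' D i).
  by move=> mD i; rewrite /B'; case: unliftP => [j|] _ /=.
have A'T i : A' i `<=` `[0, T]%classic.
  by rewrite /A'; case: unliftP => [j|] _ /=.
have tA' : trivIset setT A'.
  apply/trivIsetP => i j _ _; rewrite /A'.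
  case: unliftP => [i'|] ->; case: unliftP => [j'|] ->; rewrite ?eqxx// => ij.
  - by move/trivIsetP : tA; apply => //; apply: contraNneq ij => ->.
  - exact: AJ.
  - by rewrite setIC; exact: AJ.
pose F := \bigcap_(i in [set: 'I_k]) (fun w => N w (A i)) @^-1` B i.
have capE D : \bigcap_(i in [set: 'I_k.+1]) (fun w => N w (A' i)) @^-1` B' D i =
    F `&` (fun w => N w J) @^-1` D.
  apply/seteqP; split => w.
    move=> H; split.
      by move=> i _; have := H (lift ord0 i) Logic.I; rewrite /A' /B' liftK.
    by have := H ord0 Logic.I; rewrite /A' /B' unlift_none.
  move=> [Fw Jw] i _; rewrite /A' /B' /preimage/=.
  by case: unliftP => [j|] _ //=; exact: Fw.
have PF D : measurable D -> P (F `&` (fun w => N w J) @^-1` D) =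
    (P ((fun w => N w J) @^-1` D) * \prod_(i < k) P ((fun w => N w (A i)) @^-1` B i))%E.
  move=> mD; rewrite -capE (N_poisson.2 _ _ mA' A'T tA' _ (mB' D mD)).
  rewrite big_ord_recl /A' /B' unlift_none/=; congr (_ * _)%E.
  by apply: eq_bigr => i _; rewrite liftK.
have sF : sigma_of_random_measure T N F.
  by apply: sigma_of_random_measure_bigcap => i; exact: sigma_of_random_measure_eval.
(* With no constraint on [J], the same product formula computes [P F]. *)
have PF0 : P F = (\prod_(i < k) P ((fun w => N w (A i)) @^-1` B i))%E.
  by have := PF setT measurableT; rewrite preimage_setT setIT probability_setT mul1e.
rewrite -setIA !X0_indep//; last first.
  by apply: sigma_of_random_measureI => //; exact: sigma_of_random_measure_eval.
by rewrite PF// -PF0 [X in (_ * X)%E = _]muleC muleA.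
Qed.

Definition shifted_riemann_sum s w : \bar R :=
  ((X0 w)%:E + riemann_sum g (N w) s)%E.

Lemma shifted_riemann_sum_independent (s : seq R) t (J : set (measurableTypeR R)) C y :
  0 <= t <= T -> path <%R 0 s -> all (fun u => u < t) s ->
  measurable J -> J `<=` `[t, T]%classic -> measurable C ->
  P ([set w | shifted_riemann_sum s w <= y%:E]%E `&` (fun w => N w J) @^-1` C) =
  (P [set w | shifted_riemann_sum s w <= y%:E]%E * P ((fun w => N w J) @^-1` C))%E.
Proof.
move=> /andP[t0 tT] ps st mJ JT mC.
have s0 : all (fun x => 0 <= x) s.
  by apply: sub_all (order_path_min lt_trans ps) => x /ltW.
have ss : sorted <=%R s.
  by apply: (sub_sorted (e := <%R)) (path_sorted ps) => ? ?; exact: ltW.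
pose A (i : 'I_(size s)) : set (measurableTypeR R) :=
  `[nth 0 s i, nth 0 s i.+1[%classic.
have mA i : measurable (A i) by exact: measurable_itv.
have At i x : A i x -> 0 <= x < t.
  rewrite /A/= in_itv/= => /andP[ix xi].
  have := all_nthP 0 s0 i (ltn_ord i).
  have [si|si] := ltnP i.+1 (size s).
    by have := all_nthP 0 st i.+1 si; lra.
  by move: xi; rewrite (nth_default _ si); lra.
have AT i : A i `<=` `[0, T]%classic.
  by move=> x /At; rewrite /= in_itv/=; lra.
have JT0 : J `<=` `[0, T]%classic.
  by move=> x /JT; rewrite /= !in_itv/=; lra.
have AJ i : A i `&` J = set0.
  by rewrite -subset0 => x [/At + /JT]; rewrite /= in_itv/=; lra.
have mCJ : measurable ((fun w => N w J) @^-1` C).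
  by rewrite -[X in measurable X]setTI; apply: measurable_kernel.
apply: (independent_g_sigma_algebra (@cylinder_setI _ A) (@cylinder_setT _ A)
  (cylinder_measurable mA) mCJ).
  exact: (cylinder_independent mA AT (trivIset_sorted_itv ss) mJ JT0 AJ mC).
(* [UG] is [U] with the smaller sigma-algebra: measurability of the sum on it says that its sublevel
   sets are generated by cylinders. *)
pose UG : measurableType _ := g_sigma_algebraType (cylinder A).
have mX0 : measurable_fun (setT : set UG) (X0 : UG -> R).
  move=> _ B mB; rewrite setTI; apply: sub_gen_smallest.
  exists B, (fun=> setT); split => //.
  by rewrite -[LHS]setIT; congr (_ `&` _); apply/esym; rewrite -subTset => w _ i.
have mN i : measurable_fun (setT : set UG) ((fun w => N w (A i)) : UG -> \bar R).
  move=> _ B mB; rewrite setTI; apply: sub_gen_smallest.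
  exists setT, (fun j => if j == i then B else setT); split => //.
    by move=> j; case: ifP.
  rewrite preimage_setT setTI; apply/seteqP; split => w.
    by move=> Bw j _; rewrite /preimage/=; case: eqVneq => [->|].
  by move=> /(_ i Logic.I); rewrite /preimage/= eqxx.
have mS : measurable_fun (setT : set UG)
    ((fun w => \sum_(i < size s) (g (nth 0%R s i))%:E * N w (A i))%E : UG -> \bar R).
  by apply: emeasurable_sum => i; apply: measurable_funeM; exact: mN.
have mY : measurable_fun (setT : set UG) (shifted_riemann_sum s : UG -> \bar R).
  rewrite (_ : shifted_riemann_sum s = fun w => ((X0 w)%:E +
      \sum_(i < size s) (g (nth 0%R s i))%:E * N w (A i))%E); last first.
    by apply/funext => w; rewrite /shifted_riemann_sum (riemann_sum_nth g (N w) s0).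
  by apply: emeasurable_funD; first exact/measurable_EFinP.
have := emeasurable_fun_infty_c measurableT mY y%:E.
by rewrite setTI.
Qed.

End independence.

(** Replacing [X] by a Riemann sum and back moves the level [y] only upwards, so right-continuity is
    enough at every [y]. *)
Lemma cdf_right_near d {U : measurableType d} {R : realType} (P : probability U R)
    (X : {RV P >-> R}) (y h : R) : 0 < h ->
  exists2 dlt, 0 < dlt &
    forall e, 0 < e < dlt -> fine (cdf X (y + e)) <= fine (cdf X y) + h.
Proof.
move=> h0.
have cX : fine (cdf X r) @[r --> y^'+] --> fine (cdf X y).
  by apply: fine_cvg; rewrite fineK ?fin_num_measure//; exact: cdf_right_continuous.
have : \forall r \near y^'+, fine (cdf X r) < fine (cdf X y) + h.
  by apply: (cvgr_lt (fine (cdf X y))) => //; rewrite ltrDl.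
move=> [dlt /= dlt0 H]; exists dlt => // e /andP[e0 ed]; apply/ltW/H => /=.
  by rewrite opprD addrA subrr sub0r normrN gtr0_norm.
by rewrite ltrDl.
Qed.

Lemma cdfE d {U : measurableType d} {R : realType} (P : probability U R)
    (X : {RV P >-> R}) (y : R) : cdf X y = P [set w | X w <= y].
Proof.
by rewrite /cdf /distribution /pushforward; congr (P _); apply/seteqP; split=> w /=;
  rewrite in_itv.
Qed.

Section increment_independence.
Context d {U : measurableType d} {R : realType} (P : probability U R).
Context (T : R) (n : R -> R) (N : R.-ker U ~> measurableTypeR R) (g : R -> R).
Hypothesis N_poisson : poisson_random_measure P T n N.
Context (X0 I X : {RV P >-> R}).
Hypothesis X0_indep : independent_of_random_measure P T N X0.

Local Notation pr E := (fine (P E)).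

Lemma measurable_rv_le (Y : {RV P >-> R}) y : measurable [set w | Y w <= y].
Proof.
rewrite (_ : [set w | _] = Y @^-1` `]-oo, y]%classic).
  by rewrite -[X in measurable X]setTI; exact: measurable_funP.
by apply/seteqP; split=> w /=; rewrite in_itv.
Qed.

(** Up to small events, [X <= y] implies that the shifted sum is at most [y + e], which implies
    [X <= y + 2 * e]. Independence holds for the sum. Only an upper bound results, since the cdf may
    jump on the left of [y]. *)
Lemma shifted_integral_subindependent t (J : set (measurableTypeR R)) C y :
  0 <= t <= T -> is_poisson_integral P N g t I -> (forall w, X w = X0 w + I w) ->
  measurable J -> J `<=` `[t, T]%classic -> measurable C ->
  pr ([set w | X w <= y] `&` (fun w => N w J) @^-1` C) <=
  pr [set w | X w <= y] * pr ((fun w => N w J) @^-1` C).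
Proof.
move=> t0T It XE mJ JT mC; set E := _ @^-1` C.
have mE : measurable E.
  by rewrite /E -[X in measurable X]setTI; apply: measurable_kernel.
have mX := measurable_rv_le X.
apply/ler_addgt0Pl => h h0.
have [dlt dlt0 H] := cdf_right_near X y (h := h / 3) ltac:(lra).
(* [2 * e < dlt] allows right-continuity at [y + 2 * e]; its loss [h / 3] and two losses [e] total
   at most [h]. *)
pose e := Num.min (dlt / 3) (h / 3).
have e0 : 0 < e by rewrite lt_min; lra.
have [e1 e2] : e <= dlt / 3 /\ e <= h / 3 by rewrite /e !ge_min !lexx orbT.
have [s [B [_ _ Ps sP]]] := riemann_approximation (andP t0T).1 It e0 e0 ltr01.
have [ps st] : path <%R 0 s /\ all (fun u => u < t) s.
  by case: s sP {Ps} => // x s [/path_step_is_partition /andP[]].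
pose Yle := [set w | (shifted_riemann_sum N g X0 s w <= (y + e)%:E)%E].
have mYle : measurable Yle.
  rewrite /Yle -[X in measurable X]setTI; apply: emeasurable_fun_infty_c => //.
  apply: emeasurable_funD; first exact/measurable_EFinP.
  exact: (measurable_riemann_sum N g s).
have merr := @measurable_riemann_error _ _ _ P N g s e I.
have PYE : pr (Yle `&` E) = pr Yle * pr E.
  rewrite (shifted_riemann_sum_independent g N_poisson X0_indep _ t0T ps st mJ JT mC).
  by rewrite fineM ?fin_num_measure.
have PY1 : pr ([set w | X w <= y] `&` E) <= pr (Yle `&` E) + e.
  apply: le_trans (_ : pr (Yle `&` E) + pr (riemann_error N g s e I) <= _); last first.
    by rewrite lerD2l.
  apply: pr_le_setU => //; do ?exact: measurableI.
  move=> w [/= Xy Ew]; have [?|/negP] := pselect (riemann_error N g s e I w); first by right.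
  rewrite -ltNge => /abse_sub_lt_fin[r rE rI]; left; split => //.
  rewrite /Yle/= /shifted_riemann_sum rE -EFinD lee_fin.
  by move: Xy; rewrite XE; have := ler_norm (r - I w); lra.
have PY2 : pr Yle <= pr [set w | X w <= y + 2 * e] + e.
  apply: le_trans (_ : pr [set w | X w <= y + 2 * e] + pr (riemann_error N g s e I) <= _); last first.
    by rewrite lerD2l.
  apply: pr_le_setU => //.
  move=> w Yw; have [?|/negP] := pselect (riemann_error N g s e I w); first by right.
  rewrite -ltNge => /abse_sub_lt_fin[r rE rI]; left.
  move: Yw; rewrite /Yle/= /shifted_riemann_sum rE -EFinD lee_fin XE.
  by have := ler_norm (- (r - I w)); rewrite normrN; lra.
have := H (2 * e) ltac:(lra); rewrite !cdfE => PX.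
have E1 := pr_le1 P mE; have E0 := pr_ge0 P E.
rewrite (le_trans PY1)// PYE.
have : (pr Yle - pr [set w | X w <= y]) * pr E <= h / 3 + e.
  apply: le_trans (_ : (h / 3 + e) * pr E <= _); first by rewrite ler_wpM2r//; lra.
  by rewrite ler_piMr//; lra.
by rewrite mulrBl; lra.
Qed.

(* The preceding inequality, applied to [C] and to its complement, sums to an
   equality and is therefore sharp. *)
Lemma shifted_integral_independent t (J : set (measurableTypeR R)) C y :
  0 <= t <= T -> is_poisson_integral P N g t I -> (forall w, X w = X0 w + I w) ->
  measurable J -> J `<=` `[t, T]%classic -> measurable C ->
  pr ([set w | X w <= y] `&` (fun w => N w J) @^-1` C) =
  pr [set w | X w <= y] * pr ((fun w => N w J) @^-1` C).
Proof.
move=> t0T It XE mJ JT mC.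
have mX := measurable_rv_le X y.
have mE : measurable ((fun w => N w J) @^-1` C).
  by rewrite -[X in measurable X]setTI; apply: measurable_kernel.
have := shifted_integral_subindependent y t0T It XE mJ JT mC.
have := shifted_integral_subindependent y t0T It XE mJ JT (measurableC mC).
rewrite preimage_setC probability_setC// -{1}(fineK (fin_num_measure P _ mE)) -EFinB.
have := pr_setIC P mX mE; set a := pr _ => -> /=.
set b := fine _; set c := fine _; set p := fine _; nra.
Qed.

End increment_independence.

(** * Increments of the distribution function *)

Section cdf_increment.
Context d {U : measurableType d} {R : realType} (P : probability U R).
Context (T : R) (n : R -> R) (N : R.-ker U ~> measurableTypeR R) (g : R -> R).
Hypothesis n_density : control_density T n.
Hypothesis N_poisson : poisson_random_measure P T n N.
Context (X0 : {RV P >-> R}).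
Hypothesis X0_indep : independent_of_random_measure P T N X0.

Local Notation pr E := (fine (P E)).

Lemma pr_le_negligible (A B C : set U) : measurable A -> measurable B ->
  P.-negligible C -> A `<=` B `|` C -> pr A <= pr B.
Proof.
move=> mA mB [D [mD D0 CD]] ABC.
rewrite -[leRHS]addr0 -[X in _ + X](_ : pr D = 0); last by rewrite D0.
by apply: pr_le_setU => // w /ABC [|/CD]; [left|right].
Qed.

Section fixed_increment.
Context (t t' eps m x : R) (I I' X X' : {RV P >-> R}).
Hypotheses (t0 : 0 <= t) (tt' : t < t') (t'T : t' <= T).
Hypothesis mE : control_measure n `[t, t']%classic = m%:E.
Hypotheses (It : is_poisson_integral P N g t I)
  (It' : is_poisson_integral P N g t' I').
Hypothesis geps : forall r, t < r < t' -> `|g r - g t| <= eps.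
Hypotheses (XE : forall w, X w = X0 w + I w) (X'E : forall w, X' w = X0 w + I' w).

Local Notation M j := (count_event N `[t, t']%classic j).

Lemma pr_increment_bounds j :
  pr [set w | X w <= x - g t * j%:R - eps * j%:R] * pr (M j)
    <= pr ([set w | X' w <= x] `&` M j)
    <= pr [set w | X w <= x - g t * j%:R + eps * j%:R] * pr (M j).
Proof.
have mJ : measurable (`[t, t']%classic : set (measurableTypeR R)).
  exact: measurable_itv.
have mM : measurable (M j) by exact: measurable_count_event.
have JT : `[t, t']%classic `<=` `[t, T]%classic.
  by move=> z; rewrite /= !in_itv/=; move: t0 tt' t'T; lra.
have tT : 0 <= t <= T by move: t0 tt' t'T; lra.
have mj : measurable [set (j%:R)%:E : \bar R] by exact: emeasurable_set1.
have indep y := shifted_integral_independent N_poisson X0_indep y tT It XE mJ JT mj.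
rewrite -!indep; have null := increment_near n_density N_poisson j t0 tt' t'T mE It It' geps.
have mX := measurable_rv_le X; have mX' := measurable_rv_le X'.
apply/andP; split; apply: (pr_le_negligible _ _ null); do ?exact: measurableI.
- move=> w [/= Xw Mw]; have [bad|ok] := ltP (eps * j%:R) `|I' w - I w - g t * j%:R|.
    by right.
  left; split => //=; rewrite X'E; rewrite XE in Xw.
  by have := le_trans (ler_norm _) ok; lra.
- move=> w [/= Xw Mw]; have [bad|ok] := ltP (eps * j%:R) `|I' w - I w - g t * j%:R|.
    by right.
  left; split => //=; rewrite XE; rewrite X'E in Xw.
  by have := le_trans (ler_norm (- _)) (_ : `|- (I' w - I w - g t * j%:R)| <= _);
     rewrite normrN => /(_ _ ok); lra.
Qed.

(** [G0] is meant as the cdf of [X] at [x - g t]. Besides the error of the one-point part there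
    remains a difference of two numbers in [[0, r]], where [r] is the probability of a count other
    than 0 and 1: the share of [X' <= x] on such counts, and [r] times the cdf of [X] at [x]. *)
Lemma cdf_increment_bound (G0 h : R) :
  `|fine (cdf X (x - g t - eps)) - G0| <= h ->
  `|fine (cdf X (x - g t + eps)) - G0| <= h ->
  `|fine (cdf X' x) - fine (cdf X x) + m * expR (- m) * (fine (cdf X x) - G0)|
    <= m * expR (- m) * h + (1 - expR (- m) - m * expR (- m)).
Proof.
rewrite !cdfE => hl hr.
have mJ : measurable (`[t, t']%classic : set (measurableTypeR R)).
  exact: measurable_itv.
have JT : `[t, t']%classic `<=` `[0, T]%classic.
  by move=> z; rewrite /= !in_itv/=; move: t0 tt' t'T; lra.
have [p0E p1E] := pr_count_event n_density N_poisson mJ JT mE.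
have mM j : measurable (M j) by exact: measurable_count_event.
have mX' := measurable_rv_le X' x.
have M01 A : A `&` ~` M 0 `&` M 1 = A `&` M 1.
  apply/seteqP; split => w; first by move=> [[]].
  move=> [Aw M1]; split => //; split => // M0.
  by move: M1; rewrite /count_event /= M0 => -[] /eqP; rewrite eq_sym oner_eq0.
have split3 A : measurable A ->
    pr A = pr (A `&` M 0) + pr (A `&` M 1) + pr (A `&` ~` M 0 `&` ~` M 1).
  move=> mA; rewrite (pr_setIC P mA (mM 0%N)).
  have mAM : measurable (A `&` ~` M 0) by apply: measurableI => //; exact: measurableC.
  by rewrite (pr_setIC P mAM (mM 1%N)) M01 addrA.
have mR : measurable (~` M 0 `&` ~` M 1).
  by apply: measurableI; exact: measurableC.
have XpR : pr ([set w | X' w <= x] `&` ~` M 0 `&` ~` M 1) <= pr (~` M 0 `&` ~` M 1).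
  by rewrite -setIA; apply: pr_le => //; exact: measurableI.
have Rp := split3 _ (@measurableT _ U).
rewrite !setTI probability_setT/= p0E p1E in Rp.
have X'p := split3 _ mX'.
(* For [j = 0] the tolerance vanishes and the two bounds coincide. *)
have /andP[l0 u0] := pr_increment_bounds 0.
rewrite !mulr0 !subr0 addr0 p0E in l0 u0.
have /andP[l1 u1] := pr_increment_bounds 1.
rewrite !mulr1 p1E in l1 u1.
have a20 := pr_ge0 P ([set w | X' w <= x] `&` ~` M 0 `&` ~` M 1).
have FX0 := pr_ge0 P [set w | X w <= x].
have FX1 := pr_le1 P (measurable_rv_le X x).
have p0 := pr_ge0 P (M 1); rewrite p1E in p0.
have R0 := pr_ge0 P (~` M 0 `&` ~` M 1).
move: hl hr => /ler_normlP[hl _] /ler_normlP[_ hr].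
move: hl hr X'p Rp l0 u0 l1 u1 XpR a20 FX0 FX1 p0 R0.
set L := pr [set w | X w <= _ - _ - _]; set Rr := pr [set w | X w <= _ - _ + _].
set FX' := pr [set w | X' w <= x]; set FX := pr [set w | X w <= x].
move: (pr (_ `&` ~` M 0 `&` ~` M 1)) (pr (~` M 0 `&` ~` M 1)) => a2 r.
move: (pr (_ `&` M 0)) (pr (_ `&` M 1)) (expR (- m)) => a0 a1 p0.
move: (m * p0) => p hl hr -> Rp l0 u0 l1 u1 ar a20 FX0 FX1 p_ge0 r0.

have lp : (G0 - h) * p <= L * p by rewrite ler_wpM2r//; lra.
have rp : Rr * p <= (G0 + h) * p by rewrite ler_wpM2r//; lra.
have FXr0 : 0 <= FX * r by rewrite mulr_ge0.
have FXr1 : FX * r <= r by rewrite ler_piMl.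
have rE : r = 1 - p0 - p by lra.
rewrite rE in FXr0 FXr1; rewrite ler_norml; nra.
Qed.

End fixed_increment.
End cdf_increment.

(** Here [a] is the density at [t], [L] the increment of the cdf in time and [D] its drop from [x]
    to [x - g t]. Since [k <= 1], the factor [a + 1] bounds the mean rate [m / h], and it stays
    positive when [a = 0]. *)
Lemma poisson_rate_estimate {R : realType} (m h a k e eta D L : R) :
  0 < h -> 0 <= m -> 0 <= a -> `|a - m / h| <= k -> k <= 1 -> 0 <= eta ->
  k <= e / 4 -> (a + 1) * eta <= e / 4 -> (a + 1) * (a + 1) * h <= e / 8 ->
  `|D| <= 1 ->
  `|L + m * expR (- m) * D| <=
     m * expR (- m) * eta + (1 - expR (- m) - m * expR (- m)) ->
  `|- a * D - L / h| <= e.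
Proof.
move=> h0 m0 a0 amk k1 eta0 ke etae he D1 Lb.
have hV0 : 0 < h^-1 by rewrite invr_gt0.
set c := m / h in amk.
have mE : m = c * h by rewrite /c divfK// gt_eqF.
have c0 : 0 <= c by rewrite divr_ge0// ltW.
have ca : c <= a + 1 by move: amk; rewrite ler_norml => /andP[]; lra.
have ex1 : expR (- m) <= 1 by rewrite -expR0 ler_expR; lra.
have exm := expR_ge1Dx (- m).
set x := expR (- m) in ex1 exm Lb.
have x0 : 0 <= x by exact: expR_ge0.
(* Two uses of [1 - m <= expR (- m)] make the remaining probability quadratic in [m]. *)
have q : 1 - x - m * x <= m * m.
  have : m * (1 - m) <= m * x by rewrite ler_wpM2l//; lra.
  nra.
have cm : c * m <= e / 8.
  apply: le_trans he; rewrite mE mulrA; apply: ler_wpM2r; [exact: ltW|exact: ler_pM].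
have Lh : `|L / h + c * x * D| <= c * eta + c * m.
  have -> : L / h + c * x * D = (L + m * x * D) / h by rewrite mE; field; lra.
  rewrite normrM (gtr0_norm hV0) ler_pdivrMr//; apply: le_trans Lb _.
  have -> : (c * eta + c * m) * h = m * eta + m * m by rewrite mulrDl mulrAC -mE [c * m * h]mulrAC -mE.
  apply: lerD => //; rewrite ler_wpM2r//; first by rewrite ler_piMr.
(* The two parts are at most [k + c * m] and [c * eta + c * m], together at most three quarters of
   [e]. *)
have -> : - a * D - L / h = (c * x - a) * D - (L / h + c * x * D) by ring.
apply: le_trans (ler_normB _ _) _.
have cxa : `|c * x - a| <= k + c * m.
  have -> : c * x - a = - (a - c) - c * (1 - x) by ring.
  apply: le_trans (ler_normB _ _) _; rewrite normrN lerD// ger0_norm.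
    by rewrite ler_wpM2l//; lra.
  by rewrite mulr_ge0//; lra.
have cxD : `|(c * x - a) * D| <= k + c * m.
  by rewrite normrM; apply: le_trans cxa; rewrite ler_piMr.
apply: le_trans (lerD cxD Lh) _.
have : 0 <= c * m by rewrite mulr_ge0.
have : c * eta <= (a + 1) * eta by rewrite ler_wpM2r.
lra.
Qed.

Theorem theorem2p1 (R : realType) (d : measure_display) (U : measurableType d)
    (P : probability U R) (T : R) (n : R -> R)
    (N : R.-ker U ~> measurableTypeR R) (g : R -> R)
    (X0 : {RV P >-> R}) (I X : R -> {RV P >-> R})
    (T_gt0 : 0 < T)
    (n_density : control_density T n)
    (N_poisson : poisson_random_measure P T n N)
    (g_rcont : forall s : R, 0 <= s -> g r @[r --> s^'+] --> g s)
    (g_int : (\int[lebesgue_measure]_(s in `[0%R, T])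
                (Num.min (g s) 1 * n s)%R%:E < +oo)%E)
    (X0_indep : independent_of_random_measure P T N X0)
    (I_integral : forall t : R, 0 <= t <= T -> is_poisson_integral P N g t (I t))
    (X_def : forall t : R, 0 <= t <= T -> forall w, X t w = X0 w + I t w) :
  forall x t : R, 0 <= t < T -> right_density_at n t ->
    continuity_points (fun y => cdf_at X y t) (x - g t) ->
    (cdf_at X x (t + h) - cdf_at X x t) / h @[h --> 0^'+]
      --> - n t * (cdf_at X x t - cdf_at X (x - g t) t).
Proof.
move=> x t /andP[t0 tT] dens cont.
have nt0 : 0 <= n t by apply: n_density.2; rewrite t0 ltW.
apply/cvgrPdist_le => /= e e0.
pose a := n t; pose k := Num.min 1 (e / 4).
have k0 : 0 < k by rewrite lt_min; lra.
have [k1 ke] : k <= 1 /\ k <= e / 4 by rewrite /k !ge_min !lexx orbT.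
pose eta : R := e / (4 * (a + 1)).
have eta0 : 0 < eta by rewrite divr_gt0// mulr_gt0// /a; lra.
have etae : (a + 1) * eta <= e / 4.
  by rewrite /eta le_eqVlt; apply/orP; left; apply/eqP; field; rewrite /a; lra.
have [z /= z0 Hz] : \forall y \near x - g t,
    `|cdf_at X (x - g t) t - cdf_at X y t| <= eta.
  exact: (cvgr_dist_le _ _ cont _ eta0).
(* Half of [z] keeps [x - g t - z / 2] and [x - g t + z / 2] strictly inside the ball given by
   continuity. *)
have [r /= r0 Hr] : \forall s \near t^'+, `|g t - g s| <= z / 2.
  by apply: (cvgr_dist_le _ (g t)); [exact: g_rcont|lra].
have [fin_dens cvg_dens] := (fine_cvgP _ _).1 dens.
have e8 : 0 < e / 8 / ((a + 1) * (a + 1)).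
  by rewrite divr_gt0 ?mulr_gt0// /a; lra.
have rate_near := cvgr_dist_le _ _ cvg_dens _ k0.
near=> h.
have h0 : 0 < h by near: h; exact: nbhs_right_gt.
have hT : h < T - t by near: h; apply: nbhs_right_lt; rewrite subr_gt0.
have hr : h < r by near: h; exact: nbhs_right_lt.
have he : h <= e / 8 / ((a + 1) * (a + 1)) by near: h; exact: nbhs_right_le.
have fin_h : ((h^-1)%:E * control_measure n `[t, (t + h)%R]%classic)%E \is a fin_num.
  by near: h; exact: fin_dens.
have rate_h : `|a - fine ((h^-1)%:E * control_measure n `[t, (t + h)%R]%classic)| <= k.
  by near: h; exact: rate_near.
have hV0 : 0 < h^-1 by rewrite invr_gt0.
have JT : `[t, (t + h)%R]%classic `<=` `[0, T]%classic.
  by move=> y; rewrite /= !in_itv/=; lra.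
(* The control mass is finite near [t] because its quotient by [h] converges to a finite limit. *)
have mE : control_measure n `[t, (t + h)%R]%classic =
    (fine (control_measure n `[t, (t + h)%R]%classic))%:E.
  have := control_measure_ge0 n_density JT; move: fin_h.
  case: (control_measure n _) => [m _ _| |]//.
  by rewrite gt0_muley ?lte_fin.
move: rate_h; rewrite mE => rate_h.
apply: (poisson_rate_estimate (m := fine (control_measure n `[t, (t + h)%R]%classic)) (k := k) (eta := eta)) => //.
- by rewrite -lee_fin -mE; exact: control_measure_ge0 n_density _ JT.
- by rewrite mulrC; move: rate_h; rewrite -EFinM.
- exact: ltW.
- move: he; rewrite ler_pdivlMr; last by rewrite mulr_gt0// /a; lra.
  by rewrite mulrC.
- have tT' : 0 <= t <= T by rewrite t0 ltW.
  rewrite /cdf_at !cdfE ler_norml.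
  have mX := measurable_rv_le (X t).
  have := pr_le1 P (mX x); have := pr_ge0 P [set w | X t w <= x].
  have := pr_le1 P (mX (x - g t)); have := pr_ge0 P [set w | X t w <= x - g t].
  lra.
- have tT' : 0 <= t <= T by rewrite t0 ltW.
  have thT : 0 <= t + h <= T by lra.
  apply: (cdf_increment_bound n_density N_poisson X0_indep (I := I t) (I' := I (t + h)) t0 _ _ mE (g := g) (eps := z / 2)).
  + lra.
  + lra.
  + exact: I_integral.
  + exact: I_integral.
  + move=> s /andP[ts sth]; rewrite distrC; apply: Hr => //=.
    by rewrite distrC gtr0_norm; lra.
  + exact: X_def.
  + exact: X_def.
  + rewrite distrC; apply: Hz => /=.
    by rewrite opprD addrA subrr add0r opprK gtr0_norm; lra.
  + rewrite distrC; apply: Hz => /=.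
    by rewrite opprD addrA subrr add0r normrN gtr0_norm; lra.
Unshelve. all: by end_near.
Qed.
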